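(* Consider the equation $$P(x)\frac{d^2u}{dx^2}+Q(x)\frac{du}{dx}+R(x)u+\delta u^{p}=0,$$ where $$P(x)=1+\sum_{k=-1}^{n}a_kx^{k+2},\qquad Q(x)=\frac{\alpha}{x}+\sum_{k=-1}^{n}b_kx^{k+1},\qquad R(x)=\sum_{k=-1}^{n}c_kx^{k},$$ and put $y=1-x$, so that near $y=0$ the equation becomes $$P(1-y)\frac{d^2u}{dy^2}-Q(1-y)\frac{du}{dy}+R(1-y)u+\delta u^{p}=0,$$ where $P(1-y)$, $Q(1-y)$, $R(1-y)$ are expanded in powers of $y$ at $y=0$. Then every formal power series $u(y)=\sum_{l=0}^{\infty}d_ly^{l}$ (with real or complex coefficients) that formally satisfies this equation in $y$ converges in some neighbourhood of $y=0$, and hence defines an analytic solution there.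
   Context: Standing assumptions: $n>-1$ is an integer, $p>1$ is a natural number (the exponent), $\alpha>0$ and $\delta\neq 0$ are real constants, and $a_k,b_k,c_k$ ($-1\le k\le n$) are real coefficients. It is assumed that $P(x)=(1-x)\bar P(x)$, where $\bar P$ is a polynomial of degree at most $n+1$ with $\bar P(0)=1$, all of whose complex zeros have modulus greater than $1$; thus $P(1-y)=y\,\bar P(1-y)$ with $\bar P(1)\neq 0$, so $y=0$ is a singular point of the equation. A formal power series formally satisfies the equation if, after substitution, the coefficient of every power of $y$ vanishes. *)

(* Defs.v *)
From HB Require Import structures.
From mathcomp Require Import all_boot all_order all_algebra.
From mathcomp Require Import complex.
From mathcomp Require Import all_classical all_reals all_analysis.

Set Implicit Arguments.
Unset Strict Implicit.
Unset Printing Implicit Defensive.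

Import Order.TTheory GRing.Theory Num.Theory.
Import numFieldNormedType.Exports.

Local Open Scope classical_set_scope.
Local Open Scope ring_scope.

(* A formal power series over K is its coefficient sequence nat -> K.          *)

Definition fps_deriv (K : numFieldType) (u : nat -> K) : nat -> K :=
  fun l => l.+1%:R * u l.+1.

Definition fps_partial (K : numFieldType) (u : nat -> K) (y : K) : nat -> K :=
  series (fun l => u l * y ^+ l).

Definition fps_mul (K : numFieldType) (u v : nat -> K) : nat -> K :=
  fun l => \sum_(i < l.+1) u i * v (l - i)%N.

Definition fps_exp (K : numFieldType) (u : nat -> K) (m : nat) : nat -> K :=
  iter m (fps_mul u) (fun l => (l == 0%N)%:R).

(* The families a_k, b_k, c_k with -1 <= k <= n are indexed by j = k + 1 in    *)
(* 'I_n.+2.  P is a polynomial, whereas Q(x) = alpha / x + Qpoly(x) and        *)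
(* R(x) = c_(-1) / x + Rpoly(x).                                               *)

Definition Ppoly (K : numFieldType) (n : nat) (a : 'I_n.+2 -> K) : {poly K} :=
  1 + \sum_(j < n.+2) a j *: 'X^(j.+1).

Definition Qpoly (K : numFieldType) (n : nat) (b : 'I_n.+2 -> K) : {poly K} :=
  \sum_(j < n.+2) b j *: 'X^j.

Definition Rpoly (K : numFieldType) (n : nat) (c : 'I_n.+2 -> K) : {poly K} :=
  \sum_(j < n.+1) c (lift ord0 j) *: 'X^j.

Definition Pfun (K : numFieldType) (n : nat) (a : 'I_n.+2 -> K) (x : K) : K :=
  (Ppoly a).[x].

Definition Qfun (K : numFieldType) (n : nat) (alpha : K) (b : 'I_n.+2 -> K)
  (x : K) : K := alpha / x + (Qpoly b).[x].

Definition Rfun (K : numFieldType) (n : nat) (c : 'I_n.+2 -> K) (x : K) : K :=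
  c ord0 / x + (Rpoly c).[x].

(* Expansions of P(1 - y), Q(1 - y), R(1 - y) in powers of y at y = 0; the     *)
(* terms in 1 / x = 1 / (1 - y) = \sum_l y^l contribute the same constant to   *)
(* every coefficient.                                                          *)

Definition Pser (K : numFieldType) (n : nat) (a : 'I_n.+2 -> K) : nat -> K :=
  fun l => (Ppoly a \Po (1 - 'X))`_l.

Definition Qser (K : numFieldType) (n : nat) (alpha : K) (b : 'I_n.+2 -> K) :
  nat -> K := fun l => alpha + (Qpoly b \Po (1 - 'X))`_l.

Definition Rser (K : numFieldType) (n : nat) (c : 'I_n.+2 -> K) : nat -> K :=
  fun l => c ord0 + (Rpoly c \Po (1 - 'X))`_l.

Definition formal_solution (K : numFieldType) (n p : nat) (alpha delta : K)
  (a b c : 'I_n.+2 -> K) (d : nat -> K) : Prop :=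
  forall l : nat,
    fps_mul (Pser a) (fps_deriv (fps_deriv d)) l
    - fps_mul (Qser alpha b) (fps_deriv d) l
    + fps_mul (Rser c) d l + delta * fps_exp d p l = 0.

Definition solves_at (K : numFieldType) (n p : nat) (alpha delta : K)
  (a b c : 'I_n.+2 -> K) (u : K -> K) (y : K) : Prop :=
  Pfun a (1 - y) * derive1n 2 u y - Qfun alpha b (1 - y) * derive1 u y
  + Rfun c (1 - y) * u y + delta * u y ^+ p = 0.

Definition analytic_at (K : numFieldType) (u : K -> K) (y : K) : Prop :=
  exists (e : nat -> K) (s : K), 0 < s /\
    forall h : K, `|h| < s -> fps_partial e h @ \oo --> u (y + h).

Definition fps_sum (K : numFieldType) (d : nat -> K) (y : K) : K :=
  lim (fps_partial d y @ \oo).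

(* For K = R[i], 0 < r means that r is a positive real. *)
Definition converges_to_analytic_solution (K : numFieldType) (n p : nat)
  (alpha delta : K) (a b c : 'I_n.+2 -> K) (d : nat -> K) : Prop :=
  exists r : K, 0 < r /\
    forall y : K, `|y| < r ->
      [/\ cvg (fps_partial d y @ \oo),
          analytic_at (fps_sum d) y &
          solves_at p alpha delta a b c (fps_sum d) y].

(* Main.v *)
Require Import Defs.
From HB Require Import structures.
From mathcomp Require Import all_boot all_order all_algebra.
From mathcomp Require Import complex.
From mathcomp Require Import all_classical all_reals all_analysis.
From mathcomp Require Import ring.

Set Implicit Arguments.
Unset Strict Implicit.
Unset Printing Implicit Defensive.

Import Order.TTheory GRing.Theory Num.Theory.
Import numFieldNormedType.Exports.

Local Open Scope ring_scope.

(** The point y = 0 is a regular singular point of the equation, and there the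
    recurrence for the coefficients tames every formal solution.  Since
    P(1 - y) = y * Pbar(1 - y) with Pbar(1) <> 0, comparing coefficients of y^l
    in the equation gives a recurrence whose leading part is
    (l + 1) (l Pbar(1) - Q(1)) d_(l+1).  The bracket grows like l, so it is
    nonzero from some rank on, and the recurrence then determines d_(l+1) with
    a gain of a factor l (l + 1).  The finitely many indices at which the
    bracket may vanish only affect initial coefficients, which a formal
    solution supplies anyway.

    The factor l (l + 1) absorbs the weights that u' and u'' bring in, so that
    |d_(l+1)| <= C (|d_0| + ... + |d_l| + |(u^p)_l|) for large l
    ([coef_recurrence]).  Such an inequality forces geometric growth: the
    weighted partial sums S_N(r) = \sum_(l < N) |d_l| r^l are submultiplicative
    for the Cauchy product, whence S_(N+1) <= T + C r (2 S_N + S_N^p) for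
    r <= 1/2 and some constant T, and for r small enough
    S_N <= T + 1 is inductive ([recurrence_growth]).

    It remains to see that a power series with geometrically bounded
    coefficients may be manipulated formally inside a small disc: it can be
    re-expanded around every point ([taylor_sums]), it is differentiated term by
    term ([taylor_quadratic], [derive1_quadratic]), and Cauchy products sum to
    products ([sumsM]).  The formal identity thus becomes the differential
    equation ([formal_solution_sums]).

    The argument is the same over the reals and over the complex numbers, so it
    is carried out over a field K in which the powers of 1/2 tend to 0 and every
    series dominated by M 2^-l converges. *)

(** * Series with geometrically decreasing remainders *)

(** Convergence with an explicit rate: the fixed ratio 1/2 makes all later
    estimates additive in the constant C, without limits of sequences. *)
Definition sums (K : numFieldType) (u : nat -> K) (s : K) : Prop :=
  exists C : K, forall N, `|s - \sum_(i < N) u i| <= C * 2^-1 ^+ N.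

Definition halves_vanish (K : numFieldType) : Prop :=
  forall e : K, 0 < e -> exists N, 2^-1 ^+ N <= e.

Definition dominated_complete (K : numFieldType) : Prop :=
  forall (u : nat -> K) (M : K),
    (forall l, `|u l| <= M * 2^-1 ^+ l) -> exists s, sums u s.

Lemma half_ge0 (K : numFieldType) N : 0 <= 2^-1 ^+ N :> K.
Proof. by rewrite exprn_ge0 ?invr_ge0 ?ler0n. Qed.

Lemma half_le1 (K : numFieldType) N : 2^-1 ^+ N <= 1 :> K.
Proof. by rewrite exprn_ile1 ?invr_ge0 ?ler0n ?invf_le1 ?ler1n ?ltr0n. Qed.

Lemma half_anti (K : numFieldType) m N :
  (m <= N)%N -> 2^-1 ^+ N <= 2^-1 ^+ m :> K.
Proof.
by move=> mN; rewrite -(subnKC mN) exprD ler_piMr ?half_ge0 ?half_le1.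
Qed.

Lemma sum_half (K : numFieldType) N :
  \sum_(i < N) 2^-1 ^+ i = 2 - 2 * 2^-1 ^+ N :> K.
Proof.
elim: N => [|N IH]; first by rewrite big_ord0 expr0; ring.
by rewrite big_ord_recr /= IH exprS; field.
Qed.

Lemma sum_half_le2 (K : numFieldType) N : \sum_(i < N) 2^-1 ^+ i <= 2 :> K.
Proof. by rewrite sum_half gerBl mulr_ge0 ?half_ge0. Qed.

Lemma sum_geom_le2 (K : numFieldType) (q : K) N :
  0 <= q -> q <= 2^-1 -> \sum_(i < N) q ^+ i <= 2.
Proof.
move=> q0 q1; apply: le_trans (sum_half_le2 K N).
by apply: ler_sum => i _; rewrite lerXn2r ?nnegrE // (le_trans q0).
Qed.

Lemma sums_const_ge0 (K : numFieldType) (u : nat -> K) s C :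
  (forall N, `|s - \sum_(i < N) u i| <= C * 2^-1 ^+ N) -> 0 <= C.
Proof. by move/(_ 0%N); rewrite expr0 mulr1; exact: le_trans. Qed.

Lemma halves_small (K : numFieldType) (C e : K) : halves_vanish K ->
  0 <= C -> 0 < e -> exists N, forall m, (N <= m)%N -> C * 2^-1 ^+ m <= e.
Proof.
move=> hK C0 e0; have C1 : 0 < C + 1 by rewrite ltr_wpDl.
have [N hN] := hK _ (divr_gt0 e0 C1); exists N => m Nm.
apply: (@le_trans _ _ ((C + 1) * (e / (C + 1)))).
  by apply: ler_pM; rewrite ?half_ge0 ?lerDl // (le_trans (half_anti _ Nm)).
by rewrite mulrC divfK ?gt_eqF.
Qed.

Lemma sums_cvg (K : numFieldType) (u : nat -> K) s : halves_vanish K ->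
  sums u s -> (series u @ \oo --> s)%classic.
Proof.
move=> hK [C hC]; apply/cvgrPdist_le => e e0.
have [N hN] := halves_small hK (sums_const_ge0 hC) e0.
exists N => // m /= /hN; apply: le_trans.
by rewrite seriesEord; exact: hC.
Qed.

Lemma sums_lim (K : numFieldType) (u : nat -> K) s : halves_vanish K ->
  sums u s -> lim (series u @ \oo)%classic = s.
Proof.
by move=> hK us; apply: cvg_lim (sums_cvg hK us); exact: norm_hausdorff.
Qed.

Lemma sums_unique (K : numFieldType) (u : nat -> K) s t : halves_vanish K ->
  sums u s -> sums u t -> s = t.
Proof. by move=> hK /(sums_lim hK) <- /(sums_lim hK) <-. Qed.

(** The remainder constant 2 M depends on the domination alone, and not on how
    the limit was obtained: this uniformity is what the estimates in the index
    of the Taylor coefficients rest on. *)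
Lemma cvg_tail (K : numFieldType) (u : nat -> K) s M N :
  (series u @ \oo --> s)%classic ->
  (forall l, (N <= l)%N -> `|u l| <= M * 2^-1 ^+ l) ->
  `|s - \sum_(i < N) u i| <= 2 * M * 2^-1 ^+ N.
Proof.
move=> us uM; apply/ler_addgt0Pr => e e0.
have [m _ /(_ (N + m)%N (leq_addl _ _))] := cvgr_dist_le _ _ us _ e0.
rewrite /= seriesEord /= => hm.
have M0 : 0 <= M.
  have := le_trans (normr_ge0 _) (uM N (leqnn N)).
  by rewrite pmulr_lge0 // exprn_gt0 ?invr_gt0.
rewrite -(subrKA (\sum_(i < N + m) u i)) addrC (le_trans (ler_normD _ _)) //.
rewrite lerD // big_split_ord /= addrAC subrr add0r.
apply: le_trans (ler_norm_sum _ _ _) _.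
apply: (@le_trans _ _ (\sum_(i < m) M * 2^-1 ^+ N * 2^-1 ^+ i)).
  by apply: ler_sum => i _; rewrite -mulrA -exprD uM ?leq_addr.
have -> : 2 * M * 2^-1 ^+ N = M * 2^-1 ^+ N * 2 by ring.
rewrite -mulr_sumr ler_wpM2l ?sum_half_le2 //.
by rewrite mulr_ge0 ?half_ge0.
Qed.

Lemma sums_tail (K : numFieldType) (u : nat -> K) s M N : halves_vanish K ->
  sums u s -> (forall l, (N <= l)%N -> `|u l| <= M * 2^-1 ^+ l) ->
  `|s - \sum_(i < N) u i| <= 2 * M * 2^-1 ^+ N.
Proof. by move=> hK /(sums_cvg hK); exact: cvg_tail. Qed.

Lemma sums_bound (K : numFieldType) (u : nat -> K) s M : halves_vanish K ->
  sums u s -> (forall l, `|u l| <= M * 2^-1 ^+ l) -> `|s| <= 2 * M.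
Proof.
move=> hK us uM; have := sums_tail (N := 0) hK us (fun l _ => uM l).
by rewrite big_ord0 subr0 mulr1.
Qed.

Lemma sums_ext (K : numFieldType) (u v : nat -> K) s :
  u =1 v -> sums u s -> sums v s.
Proof.
move=> uv [C hC]; exists C => N; under eq_bigr do rewrite -uv; exact: hC.
Qed.

Lemma sumsD (K : numFieldType) (u v : nat -> K) s t :
  sums u s -> sums v t -> sums (fun l => u l + v l) (s + t).
Proof.
move=> [C hC] [D hD]; exists (C + D) => N.
by rewrite big_split opprD addrACA mulrDl (le_trans (ler_normD _ _)) ?lerD.
Qed.

Lemma sumsZ (K : numFieldType) (k : K) (u : nat -> K) s :
  sums u s -> sums (fun l => k * u l) (k * s).
Proof.
move=> [C hC]; exists (`|k| * C) => N.
by rewrite -mulr_sumr -mulrBr normrM -mulrA ler_wpM2l.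
Qed.

(** Summation over a triangle by antidiagonals or by rows; it serves Cauchy
    products as well as the binomial re-expansion of a power series. *)
Lemma sum_triangle (V : nmodType) (F : nat -> nat -> V) N :
  \sum_(l < N) \sum_(i < l.+1) F i (l - i)%N =
  \sum_(i < N) \sum_(j < N - i) F i j.
Proof.
elim: N => [|N IH]; first by rewrite !big_ord0.
rewrite big_ord_recr /= IH [X in _ + X]big_ord_recr [RHS]big_ord_recr /=.
rewrite subSnn big_ord1 subnn addrA -big_split /=; congr (_ + _).
apply: eq_bigr => i _; rewrite subSn ?big_ord_recr //; exact: ltnW.
Qed.

(** With S_N and T_N the partial sums, the error is split as
    s t - (Cauchy sum) = \sum_(i < N) u_i (t - T_(N - i)) + (s - S_N) t.
    The ratio 1/4 of u leaves a factor 2^-i, so that the errors 2^-(N - i) of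
    the inner sums add up to a multiple of 2^-N; on v only convergence is
    asked, which lets the lemma be iterated for powers. *)
Lemma sumsM (K : numFieldType) (u v : nat -> K) s t M : halves_vanish K ->
  (forall l, `|u l| <= M * 4^-1 ^+ l) -> sums u s -> sums v t ->
  sums (fps_mul u v) (s * t).
Proof.
move=> hK uM us [D hD]; have [C hC] := us.
have C0 := sums_const_ge0 hC; have D0 := sums_const_ge0 hD.
have M0 : 0 <= M.
  by have := uM 0%N; rewrite mulr1; exact: le_trans.
exists (2 * M * D + C * `|t|) => N; rewrite /fps_mul.
rewrite (sum_triangle (fun i j => u i * v j)).
under eq_bigr do rewrite -mulr_sumr.
have -> : s * t - \sum_(i < N) u i * \sum_(j < N - i) v j =
    \sum_(i < N) u i * (t - \sum_(j < N - i) v j) +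
    (s - \sum_(i < N) u i) * t.
  under [in RHS]eq_bigr do rewrite mulrBr.
  by rewrite sumrB -mulr_suml; ring.
rewrite [leRHS]mulrDl (le_trans (ler_normD _ _)) // lerD //; last first.
  by rewrite normrM mulrAC ler_wpM2r.
apply: le_trans (ler_norm_sum _ _ _) _.
apply: (@le_trans _ _ (\sum_(i < N) M * D * 2^-1 ^+ N * 2^-1 ^+ i)).
  apply: ler_sum => i _; rewrite normrM.
  apply: le_trans (ler_pM (normr_ge0 _) (normr_ge0 _) (uM i) (hD (N - i)%N)) _.
  have -> : 2^-1 ^+ N = 2^-1 ^+ (N - i) * 2^-1 ^+ i :> K.
    by rewrite -exprD subnK ?(ltnW (ltn_ord i)).
  have -> : 4^-1 = 2^-1 * 2^-1 :> K by field.
  rewrite exprMn le_eqVlt; apply/orP; left; apply/eqP; ring.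
rewrite -mulr_sumr; apply: le_trans (ler_wpM2l _ (sum_half_le2 K N)) _.
  by rewrite !mulr_ge0 ?half_ge0.
by rewrite le_eqVlt; apply/orP; left; apply/eqP; ring.
Qed.

(** * Geometric growth of the coefficients *)

Definition wsum (K : numFieldType) (u : nat -> K) (r : K) (N : nat) : K :=
  \sum_(l < N) `|u l| * r ^+ l.

Lemma ler_sum_widen (K : numDomainType) (F : nat -> K) m N :
  (forall i, 0 <= F i) -> (m <= N)%N -> \sum_(i < m) F i <= \sum_(i < N) F i.
Proof.
move=> F0 /subnKC <-; rewrite big_split_ord /= lerDl.
by apply: sumr_ge0 => i _; exact: F0.
Qed.

Lemma wsum_ge0 (K : numFieldType) (u : nat -> K) r N :
  0 <= r -> 0 <= wsum u r N.
Proof. by move=> r0; apply: sumr_ge0 => i _; rewrite mulr_ge0 ?exprn_ge0. Qed.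

Lemma wsum_fps_mul (K : numFieldType) (u v : nat -> K) r N : 0 <= r ->
  wsum (fps_mul u v) r N <= wsum u r N * wsum v r N.
Proof.
move=> r0; pose F i j := `|u i| * r ^+ i * (`|v j| * r ^+ j).
apply: (@le_trans _ _ (\sum_(l < N) \sum_(i < l.+1) F i (l - i)%N)).
  apply: ler_sum => l _.
  apply: le_trans (ler_wpM2r (exprn_ge0 _ r0) (ler_norm_sum _ _ _)) _.
  rewrite mulr_suml; apply: ler_sum => i _.
  have -> : r ^+ l = r ^+ i * r ^+ (l - i) by rewrite -exprD subnKC // -ltnS.
  by rewrite normrM mulrACA.
rewrite sum_triangle mulr_suml; apply: ler_sum => i _.
rewrite -mulr_sumr ler_wpM2l ?mulr_ge0 ?exprn_ge0 //.
apply: (ler_sum_widen (F := fun j => `|v j| * r ^+ j)); last exact: leq_subr.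
by move=> j; rewrite mulr_ge0 ?exprn_ge0.
Qed.

Lemma wsum_fps_exp (K : numFieldType) (u : nat -> K) r N p : 0 <= r ->
  wsum (fps_exp u p) r N <= wsum u r N ^+ p.
Proof.
move=> r0; elim: p => [|p IH].
  rewrite expr0 /wsum; case: N => [|N]; first by rewrite big_ord0.
  rewrite big_ord_recl /= normr1 mulr1 big1 ?addr0 // => i _.
  by rewrite normr0 mul0r.
rewrite exprS; apply: le_trans (wsum_fps_mul _ _ _ r0) _.
by rewrite ler_wpM2l ?wsum_ge0.
Qed.

(** The sequence of cumulative sums is the Cauchy product of |u| with the
    constant sequence 1, whose weighted sum is at most 2. *)
Lemma wsum_cumulative (K : numFieldType) (u : nat -> K) r N :
  0 <= r -> r <= 2^-1 ->
  \sum_(l < N) (\sum_(k < l.+1) `|u k|) * r ^+ l <= 2 * wsum u r N.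
Proof.
move=> r0 r1.
have := wsum_fps_mul (fun k => `|u k|) (fun=> 1) N r0.
have -> : wsum (fun k => `|u k|) r N = wsum u r N.
  by apply: eq_bigr => i _; rewrite normr_id.
rewrite mulrC => h; apply: le_trans (le_trans h _); last first.
  rewrite ler_wpM2r ?wsum_ge0 //; apply: le_trans (sum_geom_le2 N r0 r1).
  by apply: ler_sum => i _; rewrite normr1 mul1r.
apply: ler_sum => l _; rewrite ler_wpM2r ?exprn_ge0 // /fps_mul.
under [in leRHS]eq_bigr do rewrite mulr1.
by rewrite ger0_norm ?sumr_ge0.
Qed.

(** Method of majorants on weighted sums: one more term costs at most
    C r (2 W + W^p), where W bounds the previous weighted sum.  With T the sum
    of the |d_l| for l <= L, the choice 1/r = 2 + C (2 M + M^p) makes the bound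
    M = T + 1 propagate. *)
Lemma recurrence_growth (K : numFieldType) (d : nat -> K) p L (C : K) :
  0 <= C ->
  (forall l, (L <= l)%N ->
    `|d l.+1| <= C * (\sum_(k < l.+1) `|d k| + `|fps_exp d p l|)) ->
  exists M rho : K, [/\ 0 <= M, 0 < rho & forall l, `|d l| <= M * rho ^+ l].
Proof.
move=> C0 hd; set T := \sum_(k < L.+1) `|d k|.
have T0 : 0 <= T by apply: sumr_ge0.
pose M := T + 1; have M0 : 0 <= M by rewrite addr_ge0.
pose X := C * (2 * M + M ^+ p).
have X0 : 0 <= X by rewrite mulr_ge0 ?addr_ge0 ?mulr_ge0 ?exprn_ge0.
pose rho := 2 + X; have rho0 : 0 < rho by rewrite ltr_pwDl.
pose r := rho^-1; have r0 : 0 <= r by rewrite invr_ge0 ltW.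
have r2 : r <= 2^-1 by rewrite lef_pV2 ?posrE // lerDl.
have r1 : r <= 1 by rewrite (le_trans r2) // invf_le1 // ler1n.
have Xr : X * r <= 1 by rewrite ler_pdivrMr // mul1r lerDr.
have base : wsum d r L.+1 <= T.
  by apply: ler_sum => i _; rewrite ler_piMr // exprn_ile1.
have bnd N : wsum d r (L.+1 + N) <= M.
  elim: N => [|N IH]; first by rewrite addn0 (le_trans base) // lerDl.
  rewrite /wsum big_split_ord /= lerD //.
  apply: le_trans Xr; set W := wsum d r (L.+1 + N) in IH.
  have W0 : 0 <= W by exact: wsum_ge0.
  apply: (@le_trans _ _ (C * (2 * W + W ^+ p) * r)); last first.
    by rewrite ler_wpM2r // ler_wpM2l // lerD ?ler_wpM2l ?lerXn2r.
  pose G l := (\sum_(k < l.+1) `|d k| + `|fps_exp d p l|) * r ^+ l.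
  have G0 l : 0 <= G l.
    by rewrite mulr_ge0 ?exprn_ge0 // addr_ge0 // sumr_ge0.
  apply: (@le_trans _ _ (C * (\sum_(l < L.+1 + N) G l) * r)).
    rewrite addSnnS big_split_ord /= mulrDr mulrDl.
    rewrite ler_wpDl ?mulr_ge0 ?sumr_ge0 // mulr_sumr mulr_suml.
    apply: ler_sum => i _; rewrite /G addSn exprSr mulrA ler_wpM2r //.
    by rewrite mulrA ler_wpM2r ?exprn_ge0 // hd ?leq_addr.
  rewrite ler_wpM2r // ler_wpM2l // /G.
  under eq_bigr do rewrite mulrDl.
  rewrite big_split /= lerD //; first exact: wsum_cumulative.
  exact: wsum_fps_exp.
exists M, rho; split => // l.
have rl : 0 < r ^+ l by rewrite exprn_gt0 // invr_gt0.
rewrite -(ler_pM2r rl) -mulrA -exprMn divff ?gt_eqF // expr1n mulr1.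
apply: le_trans (bnd l); apply: (@le_trans _ _ (wsum d r l.+1)).
  by rewrite /wsum big_ord_recr /= lerDr wsum_ge0.
apply: (ler_sum_widen (F := fun l => `|d l| * r ^+ l)).
  by move=> i; rewrite mulr_ge0 ?exprn_ge0.
by rewrite addSn ltnS leq_addl.
Qed.

(** The common shape of the three convolutions of the recurrence, once the
    derivation weights in v are majorized by A. *)
Lemma norm_conv_le (K : numFieldType) (X v d : nat -> K) n j (A B : K) :
  (j <= n.+1)%N -> 0 <= A -> (forall i, `|X i| <= B) ->
  (forall i, (i < j)%N -> `|v i| <= A * `|d (n - i)%N|) ->
  `|\sum_(i < j) X i * v i| <= B * A * \sum_(k < n.+1) `|d k|.
Proof.
move=> jn A0 XB vA; have B0 : 0 <= B := le_trans (normr_ge0 _) (XB 0%N).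
rewrite [X in _ * X](reindex_inj rev_ord_inj) /=.
apply: le_trans (ler_norm_sum _ _ _) _.
apply: le_trans (_ : B * A * \sum_(i < j) `|d (n - i)%N| <= _); last first.
  rewrite ler_wpM2l ?mulr_ge0 //; under [in leRHS]eq_bigr do rewrite subSS.
  exact: (ler_sum_widen (F := fun i => `|d (n - i)%N|)).
rewrite mulr_sumr; apply: ler_sum => i _.
by rewrite normrM -mulrA ler_pM // vA.
Qed.

(** As P_0 = 0, the index l + 1 occurs in the coefficient of y^l only through
    (l + 1) (l P_1 - Q_0) d_(l+1).  As soon as |Q_0| <= l |P_1| / 2 this is at
    least (|P_1| / 2) l (l + 1) |d_(l+1)|, and the weights of all the other
    terms are at most l (l + 1). *)
Lemma coef_recurrence (K : numFieldType) (P Q S d : nat -> K) p (delta B : K) :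
  halves_vanish K -> P 0%N = 0 -> P 1%N != 0 ->
  (forall l, `|P l| <= B) -> (forall l, `|Q l| <= B) ->
  (forall l, `|S l| <= B) ->
  (forall l, fps_mul P (fps_deriv (fps_deriv d)) l
     - fps_mul Q (fps_deriv d) l + fps_mul S d l + delta * fps_exp d p l = 0) ->
  exists L (C : K), 0 <= C /\ forall l, (L <= l)%N ->
    `|d l.+1| <= C * (\sum_(k < l.+1) `|d k| + `|fps_exp d p l|).
Proof.
move=> hK P0 P1 PB QB SB eqn.
have B0 : 0 <= B := le_trans (normr_ge0 _) (PB 0%N).
pose k := `|P 1%N| / 2; have k0 : 0 < k by rewrite divr_gt0 ?normr_gt0.
have [N hN] : exists N, 2^-1 ^+ N <= k / (`|Q 0%N| + 1).
  by apply: hK; rewrite divr_gt0 // ltr_wpDl.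
exists (2 ^ N)%N, ((3 * B + `|delta|) / k); split.
  by rewrite divr_ge0 ?(ltW k0) // addr_ge0 // mulr_ge0.
move=> [|m] Nm; first by move: Nm; rewrite leqn0 expn_eq0.
have Qk : `|Q 0%N| <= k * m.+1%:R.
  apply: (@le_trans _ _ (k * 2 ^+ N)); last first.
    by rewrite ler_wpM2l ?(ltW k0) // -natrX ler_nat.
  move: hN; rewrite ler_pdivlMr ?ltr_wpDl // exprVn mulrC ler_pdivrMr ?exprn_gt0 //.
  by apply: le_trans; rewrite lerDl.
set D := \sum_(i < m.+2) `|d i|; set E := fps_exp d p m.+1.
have D0 : 0 <= D by apply: sumr_ge0.
pose A : K := m.+1%:R * m.+2%:R; have A0 : 0 < A by rewrite mulr_gt0 ?ltr0n.
have A1 : 1 <= A by rewrite /A -natrM ler1n.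
pose SP := \sum_(i < m) P i.+2 * fps_deriv (fps_deriv d) (m.+1 - i.+2)%N.
pose SQ := \sum_(i < m.+1) Q i.+1 * fps_deriv d (m.+1 - i.+1)%N.
pose SS := \sum_(i < m.+2) S i * d (m.+1 - i)%N.
have hSP : `|SP| <= B * A * D.
  apply: (norm_conv_le (X := fun i => P i.+2)
    (v := fun i => fps_deriv (fps_deriv d) (m.+1 - i.+2)%N)) => //.
  - by rewrite (leq_trans (leqnSn m)).
  - exact: ltW.
  move=> i im; rewrite /fps_deriv subSS.
  have -> : ((m - i.+1).+2 = m.+1 - i)%N by rewrite subnSK // subSn // ltnW.
  rewrite !normrM !normr_nat mulrA ler_wpM2r // /A -!natrM ler_nat leq_mul //.
    by rewrite ltnS (leq_trans (leq_subr _ _)).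
  by rewrite ltnW // ltnS (leq_trans (leq_subr _ _)).
have hSQ : `|SQ| <= B * A * D.
  apply: (norm_conv_le (X := fun i => Q i.+1)
    (v := fun i => fps_deriv d (m.+1 - i.+1)%N)) => //.
    exact: ltW.
  move=> i im; rewrite /fps_deriv subSS -subSn //.
  rewrite normrM normr_nat ler_wpM2r // /A -natrM ler_nat.
  by rewrite (leq_trans (leq_subr _ _)) // leq_pmulr.
have hSS : `|SS| <= B * A * D.
  apply: (norm_conv_le (v := fun i => d (m.+1 - i)%N)) => //; first exact: ltW.
  by move=> i _; rewrite ler_peMl.
have main : m.+2%:R * (m.+1%:R * P 1%N - Q 0%N) * d m.+2 =
    SQ - SP - SS - delta * E.
  have := eqn m.+1; rewrite /fps_mul.
  rewrite big_ord_recl P0 mul0r add0r big_ord_recl.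
  rewrite [X in _ - X + _]big_ord_recl -/E.
  rewrite -[\sum_(i < m.+2) _]/SS.
  rewrite -[\sum_(i < m) _]/SP -[\sum_(i < m.+1) _]/SQ.
  rewrite /fps_deriv /= /bump /= subn0 addn0 subn1 /= => e0.
  by apply/eqP; rewrite -subr_eq0 -e0; apply/eqP; ring.
have lower : k * m.+1%:R <= `|m.+1%:R * P 1%N - Q 0%N|.
  apply: le_trans (lerB_dist _ _); rewrite normrM normr_nat lerBrDr.
  apply: le_trans (lerD (lexx _) Qk) _.
  by rewrite /k le_eqVlt; apply/orP; left; apply/eqP; field.
rewrite mulrAC ler_pdivlMr // -(ler_pM2r A0).
apply: (@le_trans _ _ `|SQ - SP - SS - delta * E|).
  rewrite -main !normrM normr_nat.
  have -> : `|d m.+2| * k * A = m.+2%:R * (k * m.+1%:R) * `|d m.+2|.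
    by rewrite /A; ring.
  by rewrite ler_wpM2r // ler_wpM2l.
apply: (@le_trans _ _ (3 * (B * A * D) + `|delta| * `|E|)).
  rewrite (le_trans (ler_normB _ _)) // normrM lerD //.
  have -> : 3 * (B * A * D) = B * A * D + B * A * D + B * A * D by ring.
  by do 2![rewrite (le_trans (ler_normB _ _)) // lerD //].
have -> : (3 * B + `|delta|) * (D + `|E|) * A =
  3 * (B * A * D) + `|delta| * `|E| * A + (3 * B * `|E| * A + `|delta| * D * A).
  by ring.
have A0' := ltW A0.
apply: ler_wpDr; first by rewrite addr_ge0 ?mulr_ge0.
by rewrite lerD // ler_peMr ?mulr_ge0.
Qed.

(** * Local expansions and derivatives of power series *)

Lemma geom_scaled (K : numFieldType) (d : nat -> K) (M rho q y : K) :
  0 <= rho -> (forall l, `|d l| <= M * rho ^+ l) -> rho * `|y| <= q ->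
  forall l, `|d l * y ^+ l| <= M * q ^+ l.
Proof.
move=> rho0 dM yq l.
have M0 : 0 <= M by have := dM 0%N; rewrite mulr1; exact: le_trans.
rewrite normrM normrX.
apply: le_trans (ler_wpM2r (exprn_ge0 _ (normr_ge0 y)) (dM l)) _.
rewrite -mulrA ler_wpM2l // -exprMn lerXn2r ?nnegrE ?mulr_ge0 //.
by rewrite (le_trans _ yq) // mulr_ge0.
Qed.

Lemma fps_deriv_bound (K : numFieldType) (d : nat -> K) (M rho : K) :
  0 <= rho -> (forall l, `|d l| <= M * rho ^+ l) ->
  forall l, `|fps_deriv d l| <= M * rho * (2 * rho) ^+ l.
Proof.
move=> rho0 dM l; rewrite /fps_deriv normrM normr_nat.
have -> : M * rho * (2 * rho) ^+ l = 2 ^+ l * (M * rho ^+ l.+1).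
  by rewrite exprMn exprS; ring.
by apply: ler_pM => //; rewrite -natrX ler_nat ltn_expl.
Qed.

Lemma fps_sumP (K : numFieldType) (d : nat -> K) (M rho y : K) :
  halves_vanish K -> dominated_complete K ->
  0 <= rho -> (forall l, `|d l| <= M * rho ^+ l) -> rho * `|y| <= 2^-1 ->
  sums (fun l => d l * y ^+ l) (fps_sum d y).
Proof.
move=> hK cK rho0 dM yh.
have [s us] := cK _ _ (geom_scaled rho0 dM yh).
by rewrite /fps_sum /fps_partial (sums_lim hK us).
Qed.

(** The k-th divided derivative, obtained by expanding each (y + h)^l by the
    binomial formula and collecting the powers h^k. *)
Definition taylor_coef (K : numFieldType) (d : nat -> K) (y : K) (k : nat) : K :=
  fps_sum (fun l => 'C(l + k, k)%:R * d (l + k)%N) y.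

Lemma bin_le_exp2 m k : ('C(m, k) <= 2 ^ m)%N.
Proof.
elim: m k => [|m IH] [|k]; rewrite ?bin0 ?expn_gt0 //.
by rewrite binS expnS mul2n -addnn leq_add.
Qed.

Section Taylor.
Context (K : numFieldType) (d : nat -> K) (M rho y : K).
Hypotheses (hK : halves_vanish K) (cK : dominated_complete K).
Hypotheses (rho0 : 0 <= rho) (dM : forall l, `|d l| <= M * rho ^+ l).
Hypothesis yq : rho * `|y| <= 4^-1.

Let M0 : 0 <= M.
Proof. by have := dM 0%N; rewrite mulr1; exact: le_trans. Qed.

Let rho20 : 0 <= 2 * rho. Proof. by rewrite mulr_ge0. Qed.

Let y2 : 2 * rho * `|y| <= 2^-1.
Proof.
by have -> : 2^-1 = 2 * 4^-1 :> K; [field | rewrite -mulrA ler_wpM2l].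
Qed.

Let binomial_bound k l :
  `|'C(l + k, k)%:R * d (l + k)%N| <= M * (2 * rho) ^+ k * (2 * rho) ^+ l.
Proof.
rewrite normrM normr_nat.
have -> : M * (2 * rho) ^+ k * (2 * rho) ^+ l =
    2 ^+ (l + k) * (M * rho ^+ (l + k)) by rewrite !exprMn !exprD; ring.
by rewrite ler_pM // -natrX ler_nat bin_le_exp2.
Qed.

Let coef_sums k := fps_sumP hK cK rho20 (binomial_bound k) y2.
Let coef_dom k := geom_scaled rho20 (binomial_bound k) y2.

Lemma taylor_coef_bound k :
  `|taylor_coef d y k| <= 2 * M * (2 * rho) ^+ k.
Proof. by rewrite -mulrA; exact: sums_bound hK (coef_sums k) (coef_dom k). Qed.

(** Re-expansion around y.  On partial sums the rearrangement is the finite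
    identity [sum_triangle]; the k-th coefficient is then cut at N - k terms, at
    the cost of a remainder 2 M (2 rho)^k 2^-(N - k).  As (2 rho |h|)^k <= 4^-k
    for rho |h| <= 1/8, these remainders add up to at most 4 M 2^-N. *)
Lemma taylor_sums h : rho * `|h| <= 8^-1 ->
  sums (fun k => taylor_coef d y k * h ^+ k) (fps_sum d (y + h)).
Proof.
move=> hq; have yh2 : rho * `|y + h| <= 2^-1.
  apply: le_trans (ler_wpM2l rho0 (ler_normD _ _)) _; rewrite mulrDr.
  apply: le_trans (lerD yq hq) _.
  have -> : 2^-1 = 4^-1 + 8^-1 + 8^-1 :> K by field.
  by rewrite lerDl invr_ge0.
have [C hC] := fps_sumP hK cK rho0 dM yh2.
exists (C + 4 * M) => N; rewrite mulrDl.
rewrite -(subrKA (\sum_(l < N) d l * (y + h) ^+ l)).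
rewrite (le_trans (ler_normD _ _)) // lerD //.
pose F i j := 'C(j + i, i)%:R * d (j + i)%N * y ^+ j * h ^+ i.
have -> : \sum_(l < N) d l * (y + h) ^+ l =
    \sum_(k < N) (\sum_(j < N - k) 'C(j + k, k)%:R * d (j + k)%N * y ^+ j)
                   * h ^+ k.
  under [RHS]eq_bigr do rewrite mulr_suml.
  rewrite -(sum_triangle F); apply: eq_bigr => l _.
  rewrite exprDn mulr_sumr; apply: eq_bigr => i _.
  by rewrite /F subnK -1?ltnS // -[in LHS]mulr_natl; ring.
rewrite -sumrB; apply: le_trans (ler_norm_sum _ _ _) _.
apply: (@le_trans _ _ (\sum_(k < N) 2 * M * 2^-1 ^+ N * 2^-1 ^+ k)).
  apply: ler_sum => k _; rewrite -mulrBl normrM distrC.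
  have := sums_tail (N := (N - k)%N) hK (coef_sums k) (fun l _ => coef_dom k l).
  move=> /(ler_wpM2r (normr_ge0 (h ^+ k))) /le_trans; apply.
  have -> : 2^-1 ^+ N = 2^-1 ^+ (N - k) * 2^-1 ^+ k :> K.
    by rewrite -exprD subnK ?(ltnW (ltn_ord k)).
  rewrite normrX.
  have -> : 2 * (M * (2 * rho) ^+ k) * 2^-1 ^+ (N - k) * `|h| ^+ k =
      2 * M * 2^-1 ^+ (N - k) * (2 * rho * `|h|) ^+ k.
    by rewrite [in RHS]exprMn; ring.
  rewrite [leRHS](_ : _ = 2 * M * 2^-1 ^+ (N - k) * (2^-1 * 2^-1) ^+ k).
    rewrite ler_wpM2l ?mulr_ge0 ?half_ge0 // lerXn2r ?nnegrE ?mulr_ge0 //.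
    have -> : 2^-1 * 2^-1 = 2 * 8^-1 :> K by field.
    by rewrite -mulrA ler_wpM2l.
  by rewrite exprMn; ring.
rewrite -mulr_sumr; have -> : 4 * M * 2^-1 ^+ N = 2 * M * 2^-1 ^+ N * 2 by ring.
by rewrite ler_wpM2l ?sum_half_le2 ?mulr_ge0 ?half_ge0.
Qed.

(** The remainder of the local expansion after its first two terms: all
    the others carry the factor |h|^2. *)
Lemma taylor_quadratic h : rho * `|h| <= 8^-1 ->
  `|fps_sum d (y + h) - fps_sum d y - fps_sum (fps_deriv d) y * h|
    <= 16 * M * rho ^+ 2 * `|h| ^+ 2.
Proof.
move=> hq; pose q := 2 * rho * `|h|.
have q0 : 0 <= q by rewrite !mulr_ge0.
have q1 : q <= 2^-1.
  have -> : 2^-1 = 2 * 8^-1 + 4^-1 :> K by field.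
  by rewrite ler_wpDr ?invr_ge0 // /q -mulrA ler_wpM2l.
have tail l : (2 <= l)%N ->
    `|taylor_coef d y l * h ^+ l| <= 8 * M * q ^+ 2 * 2^-1 ^+ l.
  move=> l2; rewrite normrM normrX.
  apply: le_trans (ler_wpM2r (exprn_ge0 _ (normr_ge0 h)) (taylor_coef_bound l)) _.
  have -> : 2 * M * (2 * rho) ^+ l * `|h| ^+ l = 2 * M * q ^+ l.
    by rewrite [in RHS]exprMn; ring.
  rewrite -(subnKC l2) !exprD.
  have -> : 8 * M * q ^+ 2 * (2^-1 ^+ 2 * 2^-1 ^+ (l - 2)) =
     2 * M * (q ^+ 2 * 2^-1 ^+ (l - 2)) by field.
  by rewrite !ler_wpM2l ?mulr_ge0 ?exprn_ge0 // lerXn2r ?nnegrE ?invr_ge0.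
have := sums_tail hK (taylor_sums hq) tail.
rewrite 2!big_ord_recl big_ord0 /= addr0 expr0 mulr1 expr1 opprD addrA.
have -> : taylor_coef d y 0 = fps_sum d y.
  by congr (fps_sum _ _); apply/funext => l; rewrite addn0 bin0 mul1r.
have -> : taylor_coef d y 1 = fps_sum (fps_deriv d) y.
  by congr (fps_sum _ _); apply/funext => l; rewrite addn1 bin1.
move=> /le_trans; apply; rewrite le_eqVlt; apply/orP; left; apply/eqP.
by rewrite /q; field.
Qed.

End Taylor.

(** A quadratic error over a full disc is a form of differentiability that is
    insensitive to replacing f by a function equal to it on that disc; the
    second derivative is obtained that way. *)
Lemma derive1_quadratic (K : numFieldType) (f : K -> K) (y c C s : K) :
  0 < s -> 0 <= C ->
  (forall h, `|h| <= s -> `|f (y + h) - f y - c * h| <= C * `|h| ^+ 2) ->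
  derive1 f y = c.
Proof.
move=> s0 C0 fq; apply: cvg_lim; first exact: norm_hausdorff.
apply/cvgrPdist_le => e e0; near=> h.
have hn0 : h != 0 by near: h; exact: nbhs_dnbhs_neq.
have hs : `|h| <= s by near: h; exact: dnbhs0_le.
have he : `|h| <= e / (C + 1).
  by near: h; apply: dnbhs0_le; rewrite divr_gt0 // ltr_wpDl.
have -> : c - h^-1 *: (f (h + y) - f y) = - h^-1 * (f (y + h) - f y - c * h).
  by rewrite /GRing.scale /= [h + y]addrC; field.
rewrite normrM normrN normfV ler_pdivrMl ?normr_gt0 //.
apply: le_trans (fq _ hs) _; rewrite expr2 mulrA mulrC ler_wpM2l //.
apply: le_trans (_ : (C + 1) * (e / (C + 1)) <= _).
  by rewrite ler_pM // lerDl.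
by rewrite mulrC divfK // gt_eqF // ltr_wpDl.
Unshelve. all: by end_near.
Qed.

(** * From the formal equation to the differential equation *)

Lemma sums_finite (K : numFieldType) (u : nat -> K) m :
  (forall l, (m <= l)%N -> u l = 0) -> sums u (\sum_(i < m) u i).
Proof.
move=> um; exists ((\sum_(i < m) `|u i|) * 2 ^+ m) => N.
have S0 : 0 <= \sum_(i < m) `|u i| by apply: sumr_ge0.
case: (leqP m N) => [/subnKC <-|/ltnW Nm].
  rewrite big_split_ord /= opprD addrA subrr sub0r [X in - X]big1 => [|i _].
    by rewrite oppr0 normr0 !mulr_ge0 ?exprn_ge0 ?half_ge0.
  by rewrite um ?leq_addr.
apply: (@le_trans _ _ (\sum_(i < m) `|u i|)).
  rewrite -(subnKC Nm) !big_split_ord /= addrAC subrr add0r.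
  by rewrite (le_trans (ler_norm_sum _ _ _)) // lerDr sumr_ge0.
have -> : 2 ^+ m = 2 ^+ (m - N) * 2 ^+ N :> K by rewrite -exprD subnK.
rewrite -!mulrA -exprMn divff ?pnatr_eq0 // expr1n mulr1.
by rewrite ler_peMr // exprn_ege1 // ler1n.
Qed.

Lemma sums_poly (K : numFieldType) (p : {poly K}) (y : K) :
  sums (fun l => p`_l * y ^+ l) p.[y].
Proof.
rewrite horner_coef; apply: (sums_finite (u := fun l => p`_l * y ^+ l)) => l pl.
by rewrite nth_default ?mul0r.
Qed.

Lemma sums_geometric (K : numFieldType) (alpha y : K) : `|y| <= 2^-1 ->
  sums (fun l => alpha * y ^+ l) (alpha / (1 - y)).
Proof.
move=> yh; apply: sumsZ; exists `|(1 - y)^-1| => N.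
have y1 : 1 - y != 0.
  rewrite subr_eq0; apply/eqP => y1; move: yh; rewrite -y1 normr1.
  by rewrite invf_ge1 // (ler_nat K 2 1).
have -> : (1 - y)^-1 - \sum_(i < N) y ^+ i = (1 - y)^-1 * y ^+ N.
  apply: (mulfI y1); rewrite mulrBr mulrA divff // mul1r.
  by rewrite -[RHS](subrK 1) subrX1; ring.
by rewrite normrM normrX ler_wpM2l // lerXn2r ?nnegrE ?invr_ge0.
Qed.

Lemma fps_mul_scaled (K : numFieldType) (u v : nat -> K) y l :
  fps_mul u v l * y ^+ l =
  fps_mul (fun i => u i * y ^+ i) (fun j => v j * y ^+ j) l.
Proof.
rewrite /fps_mul mulr_suml; apply: eq_bigr => i _.
by rewrite mulrACA -exprD subnKC // -ltnS.
Qed.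

Lemma poly_coef_bounded (K : numFieldType) (p : {poly K}) :
  exists2 B : K, 0 <= B & forall l, `|p`_l| <= B.
Proof.
exists (\sum_(i < size p) `|p`_i|) => [|l]; first exact: sumr_ge0.
case: (ltnP l (size p)) => lp; last by rewrite nth_default ?normr0 ?sumr_ge0.
by rewrite (bigD1 (Ordinal lp)) //= lerDl sumr_ge0.
Qed.

Section Convergence.
Context (K : numFieldType) (n p : nat) (alpha delta : K).
Context (a b c : 'I_n.+2 -> K) (d : nat -> K).
Hypotheses (hK : halves_vanish K) (cK : dominated_complete K).

Lemma coefs_bounded : exists B : K,
  [/\ 0 <= B, forall l, `|Pser a l| <= B, forall l, `|Qser alpha b l| <= B
    & forall l, `|Rser c l| <= B].
Proof.
have [B1 B10 h1] := poly_coef_bounded (Ppoly a \Po (1 - 'X)).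
have [B2 B20 h2] := poly_coef_bounded (Qpoly b \Po (1 - 'X)).
have [B3 B30 h3] := poly_coef_bounded (Rpoly c \Po (1 - 'X)).
exists (B1 + (`|alpha| + B2) + (`|c ord0| + B3)).
split=> [|l|l|l]; first by rewrite !addr_ge0.
- by rewrite -addrA ler_wpDr ?addr_ge0 // h1.
- rewrite ler_wpDr ?addr_ge0 // ler_wpDl // /Qser.
  by rewrite (le_trans (ler_normD _ _)) // lerD2l.
rewrite ler_wpDl ?addr_ge0 // /Rser.
by rewrite (le_trans (ler_normD _ _)) // lerD2l.
Qed.

(** Enlarging rho to at least 1 makes |y| <= rho |y|, so that the radius of the
    disc also keeps y small enough for the expansions of P, Q and R. *)
Lemma formal_solution_growth :
  Pser a 0 = 0 -> Pser a 1 != 0 -> formal_solution p alpha delta a b c d ->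
  exists M rho : K, 1 <= rho /\ forall l, `|d l| <= M * rho ^+ l.
Proof.
move=> P0 P1 sol; have [B [_ PB QB RB]] := coefs_bounded.
have [L [C [C0 hC]]] := coef_recurrence hK P0 P1 PB QB RB sol.
have [M [rho [M0 rho0 dM]]] := recurrence_growth C0 hC.
exists M, (rho + 1); split=> [|l]; first by rewrite lerDr ltW.
apply: le_trans (dM l) _; rewrite ler_wpM2l // lerXn2r ?nnegrE ?lerDl //.
  exact: ltW.
by rewrite addr_ge0 // ltW.
Qed.

(** The left-hand side is the sum of the series whose coefficients are the
    formal left-hand sides, all of which vanish. *)
Lemma formal_solution_sums (u1 u2 u3 y : K) :
  `|y| <= 4^-1 -> formal_solution p alpha delta a b c d ->
  (exists M rho : K, [/\ 0 <= rho, forall l, `|d l| <= M * rho ^+ l &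
                         rho * `|y| <= 4^-1]) ->
  sums (fun l => d l * y ^+ l) u1 ->
  sums (fun l => fps_deriv d l * y ^+ l) u2 ->
  sums (fun l => fps_deriv (fps_deriv d) l * y ^+ l) u3 ->
  Defs.Pfun a (1 - y) * u3 - Qfun alpha b (1 - y) * u2
  + Rfun c (1 - y) * u1 + delta * u1 ^+ p = 0.
Proof.
move=> y4 sol [M [rho [rho0 dM yq]]] su su1 su2.
have y2 : `|y| <= 2^-1.
  by rewrite (le_trans y4) // lef_pV2 ?posrE // ler_nat.
have [B [B0 PB QB RB]] := coefs_bounded.
have bnd (X : nat -> K) l :
    (forall l, `|X l| <= B) -> `|X l * y ^+ l| <= B * 4^-1 ^+ l.
  move=> XB; rewrite normrM normrX ler_pM ?exprn_ge0 //.
  by rewrite lerXn2r ?nnegrE ?invr_ge0.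
have sub1 (q : {poly K}) : sums (fun l => (q \Po (1 - 'X))`_l * y ^+ l) q.[1 - y].
  have := sums_poly (q \Po (1 - 'X)) y.
  by rewrite horner_comp hornerD hornerN hornerX hornerC.
have sP : sums (fun l => Pser a l * y ^+ l) (Defs.Pfun a (1 - y)) by exact: sub1.
have sQ : sums (fun l => Qser alpha b l * y ^+ l) (Qfun alpha b (1 - y)).
  apply: sums_ext (sumsD (sums_geometric alpha y2) (sub1 (Qpoly b))) => l.
  by rewrite -mulrDl.
have sR : sums (fun l => Rser c l * y ^+ l) (Rfun c (1 - y)).
  apply: sums_ext (sumsD (sums_geometric (c ord0) y2) (sub1 (Rpoly c))) => l.
  by rewrite -mulrDl.
have prod X v s t B' : (forall l, `|X l * y ^+ l| <= B' * 4^-1 ^+ l) ->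
    sums (fun l => X l * y ^+ l) s -> sums (fun l => v l * y ^+ l) t ->
    sums (fun l => fps_mul X v l * y ^+ l) (s * t).
  move=> XB sX sv; apply: sums_ext (sumsM hK XB sX sv) => l.
  by rewrite -fps_mul_scaled.
have sE : sums (fun l => fps_exp d p l * y ^+ l) (u1 ^+ p).
  elim: p => [|m IH]; last first.
    by rewrite exprS; exact: prod (geom_scaled rho0 dM yq) su IH.
  have := @sums_finite K (fun l => fps_exp d 0 l * y ^+ l) 1.
  rewrite big_ord1 mulr1 expr0; apply => -[|l] //= _; exact: mul0r.
have total := sumsD (sumsD (sumsD
  (prod _ _ _ _ _ (fun l => bnd _ l PB) sP su2)
  (sumsZ (-1) (prod _ _ _ _ _ (fun l => bnd _ l QB) sQ su1)))
  (prod _ _ _ _ _ (fun l => bnd _ l RB) sR su)) (sumsZ delta sE).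
have zero : sums (fun=> 0 : K) 0.
  by have := @sums_finite K (fun=> 0) 0 (fun _ _ => erefl); rewrite big_ord0.
rewrite -[X in _ - X]mul1r -mulNr.
apply: (sums_unique hK) zero; apply: sums_ext total => l.
rewrite -[RHS](mul0r (y ^+ l)) -(sol l); ring.
Qed.

Theorem formal_solution_converges :
  Pser a 0 = 0 -> Pser a 1 != 0 -> formal_solution p alpha delta a b c d ->
  converges_to_analytic_solution p alpha delta a b c d.
Proof.
move=> P0 P1 sol; have [M [rho [rho1 dM]]] := formal_solution_growth P0 P1 sol.
have rhogt : 0 < rho by exact: lt_le_trans rho1.
have rho0 := ltW rhogt.
have rho20 : 0 <= 2 * rho by rewrite mulr_ge0.
have M0 : 0 <= M by have := dM 0%N; rewrite mulr1; exact: le_trans.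
have dM1 := fps_deriv_bound rho0 dM; have dM2 := fps_deriv_bound rho20 dM1.
(* Each derivation doubles rho: with rho |y| <= 1/16, the series of u' can
   still be re-expanded at y, and that of u at y + h for every |h| <= s. *)
pose s := (16 * rho)^-1; have s0 : 0 < s by rewrite invr_gt0 mulr_gt0.
have rs (z : K) : `|z| <= s -> rho * `|z| <= 16^-1.
  by move=> zs; rewrite -ler_pdivlMl // -invfM mulrC.
have r2s (z : K) : `|z| <= s -> 2 * rho * `|z| <= 8^-1.
  move=> /rs zs; have -> : 8^-1 = 2 * 16^-1 :> K by field.
  by rewrite -mulrA ler_wpM2l.
have lei (i j : nat) : (0 < j)%N -> (j <= i)%N -> i%:R^-1 <= j%:R^-1 :> K.
  by move=> j0 ji; rewrite lef_pV2 ?posrE ?ltr0n ?ler_nat // (leq_trans j0).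
have d1 z : rho * `|z| <= 4^-1 -> derive1 (fps_sum d) z = fps_sum (fps_deriv d) z.
  move=> z4; apply: (@derive1_quadratic _ _ _ _ (16 * M * rho ^+ 2) s) => //.
    by rewrite !mulr_ge0 ?exprn_ge0.
  move=> h /rs hs; apply: taylor_quadratic => //.
  exact: le_trans hs (lei 16 8 _ _).
exists s; split=> // y /ltW ys; have ry := rs _ ys.
have ry4 : rho * `|y| <= 4^-1 := le_trans ry (lei 16 4 isT isT).
have ry8 : 2 * rho * `|y| <= 4^-1 := le_trans (r2s _ ys) (lei 8 4 isT isT).
have y4 : `|y| <= 4^-1 by rewrite (le_trans _ ry4) // ler_peMl.
have su := fps_sumP hK cK rho0 dM (le_trans ry4 (lei 4 2 isT isT)).
have su1 := fps_sumP hK cK rho20 dM1 (le_trans ry8 (lei 4 2 isT isT)).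
have su2 : sums (fun l => fps_deriv (fps_deriv d) l * y ^+ l)
                (fps_sum (fps_deriv (fps_deriv d)) y).
  apply: fps_sumP hK cK _ dM2 _; first by rewrite !mulr_ge0.
  have -> : 2^-1 = 2 * 4^-1 :> K by field.
  by rewrite -mulrA ler_wpM2l.
split.
- by apply/cvg_ex; exists (fps_sum d y); exact: sums_cvg su.
- exists (taylor_coef d y), s; split=> // h /ltW /rs hs; apply: sums_cvg => //.
  exact: (taylor_sums hK cK rho0 dM ry4 (le_trans hs (lei 16 8 isT isT))).
have d2 : derive1 (derive1 (fps_sum d)) y = fps_sum (fps_deriv (fps_deriv d)) y.
  apply: (@derive1_quadratic _ _ _ _ (16 * (M * rho) * (2 * rho) ^+ 2) s) => //.
    by rewrite !mulr_ge0 ?exprn_ge0.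
  move=> h hs; rewrite !d1 //; first exact: taylor_quadratic (r2s _ hs).
  apply: le_trans (ler_wpM2l rho0 (ler_normD _ _)) _; rewrite mulrDr.
  apply: le_trans (lerD ry (rs _ hs)) _.
  have -> : 4^-1 = 16^-1 + 16^-1 + 8^-1 :> K by field.
  by rewrite lerDl invr_ge0.
rewrite /solves_at /derive1n /= d2 d1 //.
by apply: formal_solution_sums => //; exists M, rho.
Qed.

End Convergence.

(** * The real and the complex field *)

Lemma sums_of_cvg (K : numFieldType) (u : nat -> K) (s M : K) :
  (forall l, `|u l| <= M * 2^-1 ^+ l) -> (series u @ \oo --> s)%classic ->
  sums u s.
Proof.
by move=> uM us; exists (2 * M) => N; exact: cvg_tail us (fun l _ => uM l).
Qed.

Lemma halves_vanish_real (R : realType) : halves_vanish R.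
Proof.
move=> e e0; exists (Num.Def.archi_bound e^-1).
rewrite exprVn -[leRHS]invrK lef_pV2 ?posrE ?exprn_gt0 ?invr_gt0 //.
by rewrite ltW // upper_nthrootP.
Qed.

Lemma dominated_complete_real (R : realType) : dominated_complete R.
Proof.
move=> u M uM; exists (lim (series u @ \oo)%classic).
apply: (sums_of_cvg uM); apply: normed_cvg.
apply: (@series_le_cvg _ _ (geometric M 2^-1)) => [l|l|l|].
- exact: normr_ge0.
- exact: (le_trans (normr_ge0 (u l)) (uM l)).
- exact: uM.
apply: (@is_cvg_geometric_series R M); rewrite ger0_norm ?invr_ge0 //.
by rewrite invf_lt1 // ltr1n.
Qed.

Lemma halves_vanish_complex (R : realType) : halves_vanish R[i].
Proof.
move=> e; case: e => x y; rewrite ltcE /= => /andP[/eqP y0 x0].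
have [N hN] := halves_vanish_real x0; exists N.
have -> : 2^-1 ^+ N = real_complex R (2^-1 ^+ N).
  by rewrite rmorphXn fmorphV rmorph_nat.
by rewrite lecE /= y0 eqxx.
Qed.

Lemma norm_complex_le (R : realType) (z : R[i]) :
  `|z| <= real_complex R (`|complex.Re z| + `|complex.Im z|).
Proof.
have normR (x : R) : `|real_complex R x| = real_complex R `|x|.
  by rewrite normc_def /= expr0n addr0 sqrtr_sqr.
have normI : `|'i%C : R[i]| = 1.
  by rewrite normc_def /= expr0n expr1n add0r sqrtr1.
rewrite {1}[z]complexE (le_trans (ler_normD _ _)) // normrM normI mul1r.
by rewrite !normR rmorphD.
Qed.

Lemma dominated_complete_complex (R : realType) : dominated_complete R[i].
Proof.
move=> u M uM.
have M0 : 0 <= M by have := uM 0%N; rewrite mulr1; exact: le_trans.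
have half N : 2^-1 ^+ N = real_complex R (2^-1 ^+ N).
  by rewrite rmorphXn fmorphV rmorph_nat.
have [m [m0 Mm]] : exists m : R, 0 <= m /\ M = real_complex R m.
  case: (M) M0 => x y; rewrite lecE /= => /andP[/eqP -> x0]; by exists x.
have bnd l : `|complex.Re (u l)| <= m * 2^-1 ^+ l /\
             `|complex.Im (u l)| <= m * 2^-1 ^+ l.
  have := uM l; rewrite Mm half -rmorphM /= normc_def lecR => h.
  split; apply: le_trans h; rewrite -sqrtr_sqr ler_wsqrtr //.
    by rewrite lerDl sqr_ge0.
  by rewrite lerDr sqr_ge0.
have [x [C hC]] := dominated_complete_real (fun l => (bnd l).1).
have [y [D hD]] := dominated_complete_real (fun l => (bnd l).2).
exists (x +i* y)%C, (real_complex R (C + D)) => N.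
apply: le_trans (norm_complex_le _) _.
have sumRe : complex.Re (\sum_(i < N) u i) = \sum_(i < N) complex.Re (u i).
  exact: (raddf_sum (@complex.Re R)).
have sumIm : complex.Im (\sum_(i < N) u i) = \sum_(i < N) complex.Im (u i).
  exact: (raddf_sum (@complex.Im R)).
rewrite half -rmorphM /= lecR mulrDl !raddfB /= sumRe sumIm.
exact: lerD (hC N) (hD N).
Qed.

(** At y = 0 the polynomial P(1 - y) = y Pbar(1 - y) has a simple zero. *)
Lemma Pser_factor (K : numFieldType) n (a : 'I_n.+2 -> K) (Pbar : {poly K}) :
  Ppoly a = (1 - 'X) * Pbar -> Pser a 0 = 0 /\ Pser a 1 = Pbar.[1].
Proof.
move=> hP; have PX : Ppoly a \Po (1 - 'X) = 'X * (Pbar \Po (1 - 'X)).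
  rewrite hP comp_polyM; congr (_ * _).
  by rewrite comp_polyB comp_polyX comp_polyC subKr.
rewrite /Pser PX !coefXM /=; split=> //.
by rewrite -horner_coef0 horner_comp hornerD hornerN hornerX hornerC subr0.
Qed.

Lemma Pser_map (R : realType) n (a : 'I_n.+2 -> R) l :
  Pser (fun k => real_complex R (a k)) l = real_complex R (Pser a l).
Proof.
have mapP : Ppoly (fun k => real_complex R (a k)) =
    map_poly (real_complex R) (Ppoly a).
  rewrite /Ppoly rmorphD rmorph1 rmorph_sum; congr (_ + _).
  by apply: eq_bigr => j _; rewrite /= map_polyZ map_polyXn.
rewrite /Pser mapP -[RHS]coef_map map_comp_poly.
by rewrite rmorphB rmorph1 /= map_polyX.
Qed.

Theorem proposition3 (R : realType) (n p : nat) (alpha delta : R)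
  (a b c : 'I_n.+2 -> R) (Pbar : {poly R})
  (hp : (1 < p)%N) (halpha : 0 < alpha) (hdelta : delta != 0)
  (hP : Ppoly a = (1 - 'X) * Pbar)
  (hsize : (size Pbar <= n.+2)%N)
  (hPbar0 : Pbar.[0] = 1)
  (hroots : forall z : R[i],
     root (map_poly (real_complex R) Pbar) z -> 1 < `|z|) :
  (forall d : nat -> R,
     formal_solution p alpha delta a b c d ->
     converges_to_analytic_solution p alpha delta a b c d) /\
  (forall d : nat -> R[i],
     formal_solution p (real_complex R alpha) (real_complex R delta)
       (fun k => real_complex R (a k)) (fun k => real_complex R (b k))
       (fun k => real_complex R (c k)) d ->
     converges_to_analytic_solution p
       (real_complex R alpha) (real_complex R delta)
       (fun k => real_complex R (a k)) (fun k => real_complex R (b k))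
       (fun k => real_complex R (c k)) d).
Proof.
have [P0 P1] := Pser_factor hP.
(* 1 is no zero of Pbar, since its zeros have modulus greater than 1. *)
have Pbar1 : Pbar.[1] != 0.
  apply/negP => Pbar1; have := hroots 1; rewrite normr1 ltxx => /(_ _).
  case/(_ _)/notF; rewrite -(rmorph1 (real_complex R)).
  by rewrite (fmorph_root (real_complex R)).
split=> d; apply: formal_solution_converges.
- exact: halves_vanish_real.
- exact: dominated_complete_real.
- exact: P0.
- by rewrite P1.
- exact: halves_vanish_complex.
- exact: dominated_complete_complex.
- by rewrite Pser_map P0 rmorph0.
- by rewrite Pser_map P1 fmorph_eq0.
Qed.
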